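(* For each integer $j\ge2$, \[ \int_0^1 f_j(x)f_k(x)\,dx\sim\frac{j-1}{j}\cdot\frac{\log k}{2k}\qquad(k\to\infty). \]
   Context: For each integer $k\ge2$, $f_k:(0,1]\to\mathbb{R}$ is defined by $f_k(x):=\frac{1}{k}\bigl[\frac{1}{x}\bigr]-\bigl[\frac{1}{kx}\bigr]$, where $[t]$ is the integer part of $t$. Here $a_k\sim b_k$ means $a_k/b_k\to1$. *)

(* Defs.v *)
From mathcomp Require Import all_boot all_order all_algebra.
From mathcomp Require Import all_classical all_reals all_analysis.
Import Order.TTheory GRing.Theory Num.Theory.
Import numFieldNormedType.Exports.

Set Implicit Arguments.
Unset Strict Implicit.
Unset Printing Implicit Defensive.

Local Open Scope classical_set_scope.
Local Open Scope ring_scope.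

(* Total in k and x; only k >= 2 and 0 < x <= 1 are meaningful. *)
Definition f {R : realType} (k : nat) (x : R) : R :=
  k%:R^-1 * (Num.floor x^-1)%:~R - (Num.floor (k%:R * x)^-1)%:~R.

Definition asymptotic {R : realType} (a b : R^nat) : Prop :=
  (fun k => a k / b k) @ \oo --> (1 : R).

(* Main.v *)
(* For n <= 1/x < n + 1 one has f_k(x) = (n mod k)/k. On ]1/k, 1] this is n/k, so
   that k times the integral there is the sum over n < k of {n/j}/(n + 1); on
   ]0, 1/k] the integrand lies in [0, 1] and contributes at most 1/k. Since {n/j}
   has mean (j - 1)/(2j), Abel summation against a bounded periodic primitive of
   {n/j} - (j - 1)/(2j) gives k I_k = (j - 1)/(2j) ln k + O(1). *)
Require Import Defs.
From mathcomp Require Import all_boot all_order all_algebra.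
From mathcomp Require Import all_classical all_reals all_analysis.
From mathcomp Require Import ring lra.
Import Order.TTheory GRing.Theory Num.Theory.
Import numFieldNormedType.Exports.

Local Open Scope classical_set_scope.
Local Open Scope ring_scope.

(** * Pointwise values, bounds and measurability of [f] *)

Lemma f_step (R : realType) (k n : nat) (x : R) :
  (0 < k)%N -> n%:R <= x^-1 < n.+1%:R -> f k x = (n %% k)%:R / k%:R.
Proof.
move=> k0 /andP[nx xn]; have k0R : 0 < k%:R :> R by rewrite ltr0n.
have fl1 : Num.floor x^-1 = n.
  by apply: floor_def; rewrite nx /= intrD -natrD addn1.
(* Nested floors: with q = [n %/ k], one has k q <= n <= 1/x < n + 1 <= k (q + 1), so q is also the
   integer part of 1/(k x). *)
have fl2 : Num.floor (k%:R * x)^-1 = (n %/ k)%N.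
  apply: floor_def; rewrite invfM mulrC ler_pdivlMr // ltr_pdivrMr //.
  apply/andP; split.
    by apply: le_trans nx; rewrite -natrM ler_nat leq_divM.
  apply: (lt_le_trans xn).
  by rewrite intrD -natrD -natrM ler_nat addn1 ltn_ceil.
rewrite /f fl1 fl2 -!pmulrn {1}(divn_eq n k) natrD natrM.
by field; rewrite gt_eqF.
Qed.

Lemma inv_floor (R : realType) (x : R) :
  0 < x -> exists n : nat, n%:R <= x^-1 < n.+1%:R.
Proof.
move=> x0; have xv0 : 0 <= x^-1 by rewrite invr_ge0 ltW.
by exists (Num.truncn x^-1); exact: truncn_itv.
Qed.

Lemma f_itv01 (R : realType) (k : nat) (x : R) :
  (0 < k)%N -> 0 < x -> 0 <= f k x <= 1.
Proof.
move=> k0 /inv_floor[n nx]; rewrite (f_step _ _ _ _ k0 nx) divr_ge0 //=.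
by rewrite ler_pdivrMr ?ltr0n // mul1r ler_nat ltnW // ltn_mod.
Qed.

Lemma measurable_f (R : realType) (k : nat) :
  (0 < k)%N -> measurable_fun (`]0, 1]%classic : set R) (@f R k).
Proof.
move=> k0.
have mfl : measurable_fun [set: R] (fun x : R => (Num.floor x)%:~R : R).
  apply: measurable_realfun.nondecreasing_measurable => // x y xy.
  by rewrite ler_int le_floor.
have minv (c : R) : 0 < c -> measurable_fun (`]0, 1]%classic : set R) (fun x : R => (c * x)^-1).
  (* Passing to an open set that avoids 0 lets continuity of the inverse give measurability. *)
  move=> c0; apply: (measurable_funS (E := (`]0, +oo[%classic : set R))) => //.
    by move=> x /=; rewrite !in_itv /= => /andP[->].
  apply: measurable_realfun.open_continuous_measurable_fun => //.
  move=> x; rewrite inE /= in_itv /= andbT => x0.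
  apply: cvgV; first by rewrite mulf_neq0 // gt_eqF.
  by apply: cvgM; [exact: cvg_cst|exact: cvg_id].
apply: measurable_realfun.measurable_funB.
  apply: measurable_realfun.measurable_funM; first exact: measurable_cst.
  apply: (measurableT_comp mfl).
  by apply: eq_measurable_fun (minv 1 ltr01) => x _; rewrite mul1r.
by apply: (measurableT_comp mfl); apply: minv; rewrite ltr0n.
Qed.

(** * Integrals away from 0 and near 0 *)

Lemma lebesgue_measure_itvoc (R : realType) (a b : R) :
  a < b -> lebesgue_measure (`]a, b]%classic : set R) = (b - a)%:E.
Proof. by move=> ab; rewrite lebesgue_measure_itv /= lte_fin ab EFinB. Qed.

Lemma integrable_itvoc (R : realType) (g : R -> R) (a b : R) :
  a < b -> measurable_fun (`]a, b]%classic : set R) g ->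
  (forall x, a < x <= b -> 0 <= g x <= 1) ->
  (@lebesgue_measure R).-integrable `]a, b] (EFin \o g).
Proof.
move=> ab mg g01; apply: measurable_bounded_integrable => //.
  by have /= -> := lebesgue_measure_itvoc R a b ab; rewrite ltry.
exists 1; split => // M M1 x /=; rewrite in_itv /= => /g01/andP[g0 g1].
by rewrite ger0_norm // (le_trans g1) // ltW.
Qed.

Lemma Rintegral_cst_itvoc (R : realType) (r a b : R) :
  a < b -> \int[@lebesgue_measure R]_(x in `]a, b]) r = r * (b - a).
Proof.
move=> ab; rewrite Rintegral_cst //.
by have /= -> := lebesgue_measure_itvoc R a b ab.
Qed.

Lemma integrable_ff (R : realType) (j k : nat) : (0 < j)%N -> (0 < k)%N ->
  (@lebesgue_measure R).-integrable `]0, 1]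
    (EFin \o (fun x => f j x * f k x)).
Proof.
move=> j0 k0; apply: integrable_itvoc => //.
  by apply: measurable_realfun.measurable_funM; exact: measurable_f.
move=> x /andP[x0 _].
have /andP[fj0 fj1] := f_itv01 R j x j0 x0.
have /andP[fk0 fk1] := f_itv01 R k x k0 x0.
by rewrite mulr_ge0 // mulr_ile1.
Qed.

(* The i = 0 term vanishes because 0 %% j = 0, despite the junk value 0^-1 = 0. *)
Lemma integral_ff_head (R : realType) (j k n : nat) :
  (0 < j)%N -> (0 < k)%N ->
  \int[@lebesgue_measure R]_(x in `]n.+1%:R^-1, 1]) (f j x * f k x) =
  \sum_(i < n.+1) (i %% j)%:R / j%:R * ((i %% k)%:R / k%:R) *
     (i%:R^-1 - i.+1%:R^-1).
Proof.
move=> j0 k0; elim: n => [|n IHn].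
  by rewrite invr1 set_itvoc0 Rintegral_set0 big_ord1 !mod0n !mul0r.
rewrite big_ord_recr /= -IHn.
have n1 : n.+2%:R^-1 < n.+1%:R^-1 :> R.
  by rewrite ltf_pV2 ?posrE ?ltr0n // ltr_nat.
have n2 : n.+1%:R^-1 <= 1 :> R by rewrite invf_le1 ?ltr0n // ler1n.
(* The new piece ]1/(n+2), 1/(n+1)], closed on the right, is exactly where 1/x has integer part n +
   1, so both factors are constant on it. *)
rewrite (@itv_bndbnd_setU _ _ _ (BRight n.+1%:R^-1)) ?bnd_simp ?(ltW n1) //.
rewrite Rintegral_setU //; last 2 first.
- rewrite -itv_bndbnd_setU ?bnd_simp ?(ltW n1) //.
  apply: (integrableS _ _ _ (integrable_ff R j k j0 k0)) => //.
  move=> x /=; rewrite !in_itv /= => /andP[nx ->]; rewrite andbT.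
  by apply: le_lt_trans nx; rewrite invr_ge0.
- apply/disj_setPS => x /= []; rewrite !in_itv /= => /andP[_ a] /andP[b _].
  by move: (lt_le_trans b a); rewrite ltxx.
rewrite addrC; congr (_ + _).
under eq_Rintegral.
  move=> x; rewrite inE /= in_itv /= => /andP[nx xn].
  have x0 : 0 < x by apply: le_lt_trans nx; rewrite invr_ge0.
  have nx' : n.+1%:R <= x^-1 < n.+2%:R.
    rewrite -[n.+1%:R]invrK lef_pV2 ?posrE ?invr_gt0 ?ltr0n // xn /=.
    by rewrite -[n.+2%:R]invrK ltf_pV2 ?posrE ?invr_gt0 ?ltr0n.
  rewrite (f_step _ _ _ _ j0 nx') (f_step _ _ _ _ k0 nx').
  over.
by rewrite Rintegral_cst_itvoc.
Qed.

(** The integrand lies in [0, 1], so the length of the interval is a bound. For n + 1 = k this costs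
    at most 1 after multiplication by k. *)
Lemma integral_ff_tail (R : realType) (j k n : nat) :
  (0 < j)%N -> (0 < k)%N ->
  0 <= \int[@lebesgue_measure R]_(x in `]0, n.+1%:R^-1]) (f j x * f k x)
    <= n.+1%:R^-1.
Proof.
move=> j0 k0; have n0 : 0 < n.+1%:R^-1 :> R by rewrite invr_gt0.
have n1 : n.+1%:R^-1 <= 1 :> R by rewrite invf_le1 ?ltr0n // ler1n.
have sub : `]0, n.+1%:R^-1] `<=` (`]0, 1] : set R).
  by move=> x /=; rewrite !in_itv /= => /andP[-> /le_trans ->].
apply/andP; split.
  apply: Rintegral_ge0 => x /=; rewrite in_itv /= => /andP[x0 _].
  by apply: mulr_ge0; [have /andP[] := f_itv01 R j x j0 x0
                      |have /andP[] := f_itv01 R k x k0 x0].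
apply: (@le_trans _ _ (\int[@lebesgue_measure R]_(x in `]0, n.+1%:R^-1]) 1)).
  apply: le_Rintegral => //.
  - by apply: (integrableS _ _ _ (integrable_ff R j k j0 k0)).
  - by apply: integrable_itvoc => // x _; rewrite ler01 lexx.
  move=> x /=; rewrite in_itv /= => /andP[x0 _].
  have /andP[fj0 fj1] := f_itv01 R j x j0 x0.
  have /andP[fk0 fk1] := f_itv01 R k x k0 x0.
  by rewrite mulr_ile1.
by rewrite Rintegral_cst_itvoc // mul1r subr0.
Qed.

(** * Logarithmic growth of the residue sums *)

(** Both sides come from ln (1 + y) <= y, at y = -1/(x + 1) and at y = 1/x. *)
Lemma ln_succ (R : realType) (x : R) : 0 < x ->
  (x + 1)^-1 <= ln (x + 1) - ln x <= x^-1.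
Proof.
move=> x0; have x10 : 0 < x + 1 by rewrite addr_gt0.
apply/andP; split.
  rewrite -lerN2 opprB -ln_div ?posrE //.
  have -> : x / (x + 1) = 1 + - (x + 1)^-1 by field; rewrite gt_eqF.
  by apply: le_ln1Dx; rewrite ltrN2 invf_lt1 // ltrDr.
rewrite -ln_div ?posrE //.
have -> : (x + 1) / x = 1 + x^-1 by field; rewrite gt_eqF.
by apply: le_ln1Dx; rewrite (lt_trans (ltrN10 R)) // invr_gt0.
Qed.

Lemma harmonic_ln (R : realType) (n : nat) :
  @ln R n.+2%:R <= \sum_(i < n.+1) i.+1%:R^-1 <= 1 + @ln R n.+1%:R.
Proof.
elim: n => [|n /andP[IH1 IH2]].
  rewrite big_ord1 ln1 invr1 addr0 lexx andbT.
  by have /andP[_] := ln_succ R 1 ltr01; rewrite ln1 subr0 invr1.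
rewrite big_ord_recr /=.
have /andP[_] := ln_succ R n.+2%:R (ltr0Sn _ _).
have /andP[+ _] := ln_succ R n.+1%:R (ltr0Sn _ _).
rewrite !natr1; set v := n.+2%:R^-1 => a b.
by apply/andP; split; clearbody v; lra.
Qed.

(* With r = m mod j, the sum of {i/j} - (j - 1)/(2j) over i < m is r(r - j)/(2j). *)
Definition residue_potential (R : realType) (j m : nat) : R :=
  (m %% j)%:R * ((m %% j)%:R - j%:R) / (2 * j%:R).

Lemma residue_potentialS (R : realType) (j m : nat) : (0 < j)%N ->
  residue_potential R j m.+1 - residue_potential R j m =
  (m %% j)%:R / j%:R - (j%:R - 1) / (2 * j%:R).
Proof.
move=> j0; have jR : j%:R != 0 :> R by rewrite pnatr_eq0 -lt0n.
have e : (m.+1 %% j = (m %% j).+1 %% j)%N by rewrite -[m.+1]addn1 -modnDml addn1.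
have := ltn_pmod m j0; rewrite /residue_potential {}e.
(* Either r + 1 = j and the residue wraps around to 0, where the potential vanishes, or it simply
   increases by 1. *)
move: (m %% j)%N => r; rewrite leq_eqVlt => /predU1P[<-|rj].
  by rewrite modnn !mul0r sub0r -natr1; field; rewrite natr1 pnatr_eq0.
by rewrite modn_small // -natr1; field.
Qed.

(** A crude consequence of 0 <= r <= j; what matters is that the bound does not depend on [m]. *)
Lemma residue_potential_le (R : realType) (j m : nat) : (0 < j)%N ->
  `|residue_potential R j m| <= j%:R.
Proof.
move=> j0; have jR : 0 < j%:R :> R by rewrite ltr0n.
have rj : (m %% j)%:R <= j%:R :> R by rewrite ler_nat ltnW // ltn_mod.
have r0 : 0 <= (m %% j)%:R :> R by [].
rewrite /residue_potential normrM normfV ler_pdivrMr ?normr_gt0; last by lra.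
rewrite [X in _ <= _ * X]gtr0_norm; last by lra.
rewrite ler0_norm; nra.
Qed.

(** Abel summation, with p the potential: since p(0) = 0, the difference is the sum over i < n of
    p(i+1) (1/(i+1) - 1/(i+2)). With |p| <= j the weights telescope to the right-hand side. *)
Lemma residue_sum_bound (R : realType) (j n : nat) : (0 < j)%N ->
  `|\sum_(i < n) ((i %% j)%:R / j%:R - (j%:R - 1) / (2 * j%:R)) / i.+1%:R
     - residue_potential R j n / n.+1%:R| <= j%:R * (1 - n.+1%:R^-1).
Proof.
move=> j0; elim: n => [|n IHn].
  by rewrite big_ord0 /residue_potential mod0n !mul0r invr1 !subrr mulr0 normr0.
rewrite big_ord_recr /= -residue_potentialS //.
set T := \sum_(i < n) _ in IHn *; set p := residue_potential R j n in IHn *.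
have p1 := residue_potential_le R j n.+1 j0.
set p' := residue_potential R j n.+1 in p1 *.
have -> : T + (p' - p) / n.+1%:R - p' / n.+2%:R =
    (T - p / n.+1%:R) + p' * (n.+1%:R^-1 - n.+2%:R^-1) by ring.
apply: (le_trans (ler_normD _ _)).
have d0 : 0 <= n.+1%:R^-1 - n.+2%:R^-1 :> R.
  by rewrite subr_ge0 lef_pV2 ?posrE ?ltr0n // ler_nat.
rewrite normrM (ger0_norm d0).
move: IHn (ler_wpM2r d0 p1); move: (n.+1%:R^-1) (n.+2%:R^-1) => u v; lra.
Qed.

(** The constant collects j from the Abel remainder, j from the boundary term and 1 from replacing
    the harmonic sum by the logarithm. *)
Lemma residue_sum_ln (R : realType) (j n : nat) : (0 < j)%N ->
  `|\sum_(i < n.+1) (i %% j)%:R / j%:R / i.+1%:R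
     - (j%:R - 1) / (2 * j%:R) * ln n.+1%:R| <= 2 * j%:R + 1 :> R.
Proof.
move=> j0; have j1 : 1 <= j%:R :> R by rewrite ler1n.
set a : R := (j%:R - 1) / (2 * j%:R).
have a0 : 0 <= a by rewrite divr_ge0 ?subr_ge0 ?mulr_ge0.
have a1 : a <= 1 by rewrite ler_pdivrMr ?mulr_gt0 //; lra.
have := residue_sum_bound R j n.+1 j0.
have pj := residue_potential_le R j n.+1 j0.
have v0 : 0 <= n.+2%:R^-1 :> R by rewrite invr_ge0.
have v1 : n.+2%:R^-1 <= 1 :> R by rewrite invf_le1 // ler1n.
have /andP[h1 h2] := harmonic_ln R n.
have h3 : ln n.+1%:R <= ln n.+2%:R :> R by rewrite ler_ln ?posrE // ler_nat.
under eq_bigr do rewrite mulrBl.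
rewrite sumrB -mulr_sumr -/a.
set S := \sum_(i < n.+1) (i %% j)%:R / _ / _; set H := \sum_(i < _) _ in h1 h2 *.
set p := residue_potential R j n.+1 in pj *.
have pv : `|p / n.+2%:R| <= j%:R.
  rewrite normrM (ger0_norm (x := n.+2%:R^-1)) // -[leRHS]mulr1.
  exact: ler_pM.
have aH : 0 <= a * (H - ln n.+1%:R) <= 1.
  have d0 : 0 <= H - ln n.+1%:R by rewrite subr_ge0 (le_trans h3).
  have d1 : H - ln n.+1%:R <= 1 by rewrite lerBlDr.
  by rewrite mulr_ge0 // mulr_ile1.
have jv : 0 <= j%:R * n.+2%:R^-1 :> R by rewrite mulr_ge0.
clearbody S H p a; move: pv jv aH; rewrite !ler_norml.
move: (n.+2%:R^-1) (ln n.+1%:R) => v L.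
move=> /andP[p1 p2] jv /andP[b0 b1] /andP[q1 q2].
by apply/andP; split; lra.
Qed.

(** * The integral up to O(1/k), and the limit *)

Lemma integral_ff_ln (R : realType) (j k : nat) : (0 < j)%N -> (0 < k)%N ->
  `|k%:R * \int[@lebesgue_measure R]_(x in `]0, 1]) (f j x * f k x)
     - (j%:R - 1) / (2 * j%:R) * ln k%:R| <= 2 * j%:R + 2.
Proof.
move=> j0; case: k => // n _.
have n0 : 0 < n.+1%:R^-1 :> R by rewrite invr_gt0.
have n1 : n.+1%:R^-1 <= 1 :> R by rewrite invf_le1 ?ltr0n // ler1n.
have ii := integrable_ff R j n.+1 j0 isT.
rewrite (@itv_bndbnd_setU _ _ _ (BRight n.+1%:R^-1)) ?bnd_simp ?(ltW n0) //.
rewrite Rintegral_setU //; last 2 first.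
- by rewrite -itv_bndbnd_setU ?bnd_simp ?(ltW n0).
- apply/disj_setPS => x /= []; rewrite !in_itv /= => /andP[_ a] /andP[b _].
  by move: (lt_le_trans b a); rewrite ltxx.
rewrite integral_ff_head //.
(* Below k = n + 1 the residue mod k is i itself, and i (1/i - 1/(i+1)) = 1/(i+1). The case i = 0 is
   separate, both terms being killed by [0 %% j]. *)
have -> : \sum_(i < n.+1) (i %% j)%:R / j%:R * ((i %% n.+1)%:R / n.+1%:R) *
     (i%:R^-1 - i.+1%:R^-1) =
   n.+1%:R^-1 * \sum_(i < n.+1) (i %% j)%:R / j%:R / i.+1%:R :> R.
  rewrite mulr_sumr; apply: eq_bigr => -[[|i] /= ilt] _.
    by rewrite !mod0n !mul0r mulr0.
  rewrite (modn_small ilt) -[i.+2%:R]natr1.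
  move: (ltr0Sn R i) (ltr0Sn R n) (_ %% j)%:R => i0 n0' r.
  move: i.+1%:R n.+1%:R i0 n0' => x y x0 y0; field.
  by rewrite !gt_eqF ?addr_gt0 // ltr0n.
rewrite mulrDr mulrA divff ?pnatr_eq0 // mul1r.
have /andP[t0 t1] := integral_ff_tail R j n.+1 n j0 isT.
set t := Rintegral _ _ _ in t0 t1 *.
have s0 : 0 <= n.+1%:R * t by rewrite mulr_ge0.
have s1 : n.+1%:R * t <= 1 by rewrite mulrC -ler_pdivlMr // div1r.
have := residue_sum_ln R j n j0.
rewrite !ler_norml => /andP[q1 q2].
by apply/andP; split; lra.
Qed.

Theorem theorem17 (R : realType) (j : nat) (hj : (2 <= j)%N) :
  asymptotic
    (fun k : nat => \int[@lebesgue_measure R]_(x in `]0, 1]) (f j x * f k x))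
    (fun k : nat => (j%:R - 1) / j%:R * (ln k%:R / (2 * k%:R))).
Proof.
have j1 : 1 < j%:R :> R by rewrite ltr1n.
pose a : R := (j%:R - 1) / (2 * j%:R).
(* The hypothesis j >= 2 enters here: for j = 1 the leading coefficient would vanish. *)
have a0 : 0 < a by rewrite divr_gt0 ?subr_gt0 ?mulr_gt0 // (lt_trans ltr01).
pose C : R := 2 * j%:R + 2.
have lnoo : (ln (k%:R : R)) @[k --> \oo] --> +oo.
  apply/cvgryPge => A; near=> k.
  (* Writing A as ln (exp A) reduces the claim to k >= exp A. *)
  rewrite -[A]expRK ler_ln ?posrE ?expR_gt0 //; last first.
    by apply: lt_le_trans (expR_gt0 A) _; near: k; exact: nbhs_infty_ger.
  by near: k; exact: nbhs_infty_ger.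
have lnV : (ln (k%:R : R))^-1 @[k --> \oo] --> 0.
  apply/gtr0_cvgV0 => //; near=> k; apply: ln_gt0; rewrite ltr1n.
  by near: k; exact: nbhs_infty_gt.
have CV (c : R) : (fun k : nat => 1 + c / a * (ln k%:R)^-1) @ \oo --> (1 : R).
  rewrite -[X in _ --> X]addr0 -[X in _ + X](mulr0 (c / a)).
  by apply: cvgD; [exact: cvg_cst|apply: cvgM => //; exact: cvg_cst].
apply: (squeeze_cvgr _ (CV (- C)) (CV C)); near=> k.
have k1 : (1 < k)%N by near: k; exact: nbhs_infty_gt.
have k0 : (0 < k)%N by exact: ltnW.
have L0 : 0 < ln k%:R :> R by rewrite ln_gt0 // ltr1n.
have kR : k%:R != 0 :> R by rewrite pnatr_eq0 -lt0n.
have := integral_ff_ln R j k (ltnW hj) k0.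
rewrite -/a -/C; set I := Rintegral _ _ _; set L := ln _ in L0 *.
(* The comparison function is a L / k, so the quotient differs from 1 by the O(1) error over a L,
   which gives the bounds 1 - C/(a L) and 1 + C/(a L). *)
have -> : I / ((j%:R - 1) / j%:R * (L / (2 * k%:R))) = 1 + (k%:R * I - a * L) / a * L^-1.
  rewrite /a; field.
  by rewrite kR !gt_eqF ?subr_gt0 // (lt_trans ltr01).
rewrite ler_norml => /andP[q1 q2].
by rewrite !lerD2l !ler_pM2r ?invr_gt0 // q1 q2.
Unshelve. all: by end_near.
Qed.
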